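(* Let $N\ge 2$, let $\mathcal{K}\subseteq\mathbb{Z}_N$ be an $(N,K,\lambda)$ difference set, and let $\Phi_{\mathcal{K}}=\{M_jT_kv\}_{j,k=0}^{N-1}\subset\mathbb{C}^N$ be the Gabor system generated by $\mathcal{K}$, where $v=\frac{1}{\sqrt{K}}\chi_{\mathcal{K}}$. Then the mutual coherence of $\Phi_{\mathcal{K}}$ is $$\mu(\Phi_{\mathcal{K}})=\begin{cases}\sqrt{\dfrac{N-K}{K(N-1)}}, & \text{if }\lambda=1,\\[2ex] \max\left\{\dfrac{K-1}{N-1},\ \sqrt{\dfrac{N-K}{K(N-1)}}\right\}, & \text{if }\lambda\neq 1.\end{cases}$$
   Context: $\mathbb{Z}_N=\{0,1,\dots,N-1\}$ with arithmetic modulo $N$; vectors in $\mathbb{C}^N$ are indexed by $\mathbb{Z}_N$, and all index operations are modulo $N$. Difference set: a nonempty subset $\mathcal{K}=\{u_1,\dots,u_K\}\subseteq\mathbb{Z}_N$ with $K$ elements is an $(N,K,\lambda)$ difference set if the $K(K-1)$ differences $(u_k-u_l)\bmod N$, $k\ne l$, take all nonzero values $1,2,\dots,N-1$, each exactly $\lambda$ times. $\chi_{\mathcal{K}}\in\mathbb{C}^N$ is the characteristic function of $\mathcal{K}$: $\chi_{\mathcal{K}}(j)=1$ if $j\in\mathcal{K}$ and $0$ otherwise. Modulation and translation operators on $\mathbb{C}^N$: $(M_jg)(n)=e^{2\pi i jn/N}g(n)$ and $(T_kg)(n)=g(n-k)$ for $n=0,\dots,N-1$. Mutual coherence of an indexed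 family $\Phi=\{\phi_i\}_{i=1}^M$ of nonzero vectors: $\mu(\Phi)=\max_{i\ne j}\frac{|\langle\phi_i,\phi_j\rangle|}{\|\phi_i\|\,\|\phi_j\|}$ (maximum over distinct indices). For $\Phi_{\mathcal{K}}$ the index set is the set of pairs $(j,k)\in\{0,\dots,N-1\}^2$. *)

(* Defs.v *)
From mathcomp Require Import all_boot all_order all_algebra.
From mathcomp Require Import complex.
From mathcomp Require Import reals trigo.

Set Implicit Arguments.
Unset Strict Implicit.
Unset Printing Implicit Defensive.

Import Order.TTheory GRing.Theory Num.Theory.
Local Open Scope ring_scope.
Local Open Scope complex_scope.

(* 'Z_N is the ring of integers modulo N only when 1 < N; every use below is
   meant under that hypothesis.  An element of 'Z_N coerces to its
   representative in {0, ..., N-1}. *)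

(* lambda = 0 is not excluded: it occurs exactly when K = 1. *)
Definition difference_set (N : nat) (A : {set 'Z_N}) (K lambda : nat) : Prop :=
  [/\ A != set0,
      #|A| = K &
      forall d : 'Z_N, d != 0 ->
        #|[set p in setX A A | (p.1 != p.2) && (p.1 - p.2 == d)]| = lambda].

Section ComplexVectors.
Variables (R : realType) (T : finType).
Implicit Types f g : {ffun T -> R[i]}.

Definition inner f g : R[i] := \sum_t f t * (g t)^*.

Definition l2norm f : R := Num.sqrt (\sum_t ComplexField.Normc.normc (f t) ^+ 2).

(* All the ratios are nonnegative, so the default value 0 of the iterated max
   does not affect the maximum as soon as I has two distinct elements. *)
Definition mutual_coherence (I : finType) (Phi : I -> {ffun T -> R[i]}) : R :=
  \big[Num.max/0]_(p : I * I | p.1 != p.2)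
    (ComplexField.Normc.normc (inner (Phi p.1) (Phi p.2))
      / (l2norm (Phi p.1) * l2norm (Phi p.2))).

End ComplexVectors.

Section Gabor.
Variables (R : realType) (N : nat).
Implicit Types (g : {ffun 'Z_N -> R[i]}) (A : {set 'Z_N}).

Definition expi (theta : R) : R[i] := cos theta +i* sin theta.

Definition modulation (j : 'Z_N) g : {ffun 'Z_N -> R[i]} :=
  [ffun n : 'Z_N => expi (2 * pi * (j * n)%N%:R / N%:R) * g n].

Definition translation (k : 'Z_N) g : {ffun 'Z_N -> R[i]} :=
  [ffun n : 'Z_N => g (n - k)].

Definition char_fun A : {ffun 'Z_N -> R[i]} := [ffun n => (n \in A)%:R].

Definition window A : {ffun 'Z_N -> R[i]} :=
  [ffun n => (1 / Num.sqrt #|A|%:R)%:C * char_fun A n].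

Definition gabor_system A (jk : 'Z_N * 'Z_N) : {ffun 'Z_N -> R[i]} :=
  modulation jk.1 (translation jk.2 (window A)).

End Gabor.

(* Main.v *)
Require Import Defs.
From mathcomp Require Import all_boot all_order all_algebra.
From mathcomp Require Import complex.
From mathcomp Require Import reals trigo.
From mathcomp Require Import ring lra zify.

(** Writing [zchar a] for [exp (2 pi i a / N)], the inner product of
    [M_j T_k v] and [M_j' T_l v] is [1 / K] times the sum of
    [zchar ((j - j') n)] over the [n] lying in both translates [A + k] and
    [A + l] ([inner_gabor_system]).  All vectors are unit vectors, so the
    coherence is the largest modulus of such a sum, divided by [K].

    If [k] and [l] differ, the two translates meet in exactly [lambda] points
    ([card_cross_translates]), since these points correspond to the ways of
    writing [l - k] as a difference in [A].  The modulus is thus at most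
    [lambda], with equality when [j = j'] since every term is then [1]; and
    [lambda / K = (K - 1) / (N - 1)] by counting pairs.

    If [k = l], the sum is up to a unit factor the Fourier coefficient of the
    indicator of [A] at the nonzero frequency [j - j'].  Its squared modulus is
    a double sum over [A] depending only on differences, each nonzero one being
    taken [lambda] times and [0] being taken [K] times.  Since a nontrivial
    character sums to zero, this leaves [K - lambda] ([sqr_normc_char_sum]),
    which gives the square root of the formula.

    Hence the coherence is always the maximum of the two values
    ([gabor_coherence]).  When [lambda = 1], i.e. [N - 1 = K (K - 1)], the first
    one is [1 / K] and the second one is [sqrt (K - 1) / K], which is at least
    as large because [K >= 2] ([planar_bound]). *)

Set Implicit Arguments.
Unset Strict Implicit.
Unset Printing Implicit Defensive.

Import Order.TTheory GRing.Theory Num.Theory.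
Local Open Scope ring_scope.

Local Notation normc := ComplexField.Normc.normc.
Local Notation "x %:C" := (real_complex _ x).

(** * Complex modulus and exponential *)

Section ComplexModulus.
Variable R : realType.
Implicit Types (z : R[i]) (x y : R).

Lemma sqr_normcE z : (normc z ^+ 2)%:C = z * z^*.
Proof. by rewrite rmorphXn /= -normCK. Qed.

Lemma normc_ge0 z : 0 <= normc z.
Proof. by case: z => a b; exact: sqrtr_ge0. Qed.

Lemma normc_real x : 0 <= x -> normc x%:C = x.
Proof. by move=> x0; rewrite /= expr0n addr0 sqrtr_sqr ger0_norm. Qed.

Lemma normc_sum_le (I : finType) (P : pred I) (F : I -> R[i]) :
  normc (\sum_(i | P i) F i) <= \sum_(i | P i) normc (F i).
Proof.
elim/big_ind2: _ => [|x1 x2 y1 y2 h1 h2|//].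
  by rewrite ComplexField.Normc.normc0.
exact: le_trans (le_normcD _ _) (lerD h1 h2).
Qed.

Lemma expiD x y : expi (x + y) = expi x * expi y.
Proof.
rewrite /expi cosD sinD; apply/eqP; rewrite eq_complex /= eqxx /=.
by apply/eqP; ring.
Qed.

Lemma expi0 : expi (0 : R) = 1.
Proof. by rewrite /expi cos0 sin0. Qed.

Lemma conj_expi x : (expi x)^* = expi (- x).
Proof. by rewrite -[LHS]/(conjc _) /expi cosN sinN. Qed.

Lemma normc_expi x : normc (expi x) = 1.
Proof. by rewrite /= cos2Dsin2 sqrtr1. Qed.

Lemma expi_2pi_nat (q : nat) : expi (2 * pi * q%:R : R) = 1.
Proof.
elim: q => [|q IH]; first by rewrite mulr0 expi0.
rewrite -[q.+1%:R]natr1 mulrDr mulr1 expiD IH mul1r.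
by rewrite /expi mulr_natl cos2pi sin2pi.
Qed.

(** Halving the angle turns [cos x = 1] into [sin (x / 2) = 0], which is
    impossible strictly between [0] and [pi]. *)
Lemma expi_neq1 x : 0 < x < 2 * pi -> expi x != 1.
Proof.
case/andP=> x0 x2; rewrite /expi eq_complex /= negb_and; apply/orP; left.
have -> : x = (x / 2) *+ 2 by rewrite -mulr_natr; field.
rewrite cos_mulr2n cos2sin2.
have s0 : 0 < sin (x / 2) by apply: sin_gt0_pi; lra.
have : 0 < sin (x / 2) ^+ 2 by rewrite exprn_gt0.
by move=> s2; apply/eqP; lra.
Qed.

End ComplexModulus.

(** * Characters of the cyclic group of order N *)

Section CyclicCharacters.
Variables (R : realType) (N : nat).
Hypothesis N_gt1 : (1 < N)%N.
Implicit Types a b d j n : 'Z_N.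

Definition zchar a : R[i] := expi (2 * pi * (a : nat)%:R / N%:R).

Let N_neq0 : N%:R != 0 :> R.
Proof. by rewrite pnatr_eq0 -lt0n (ltn_trans _ N_gt1). Qed.

(** Reduces the exponential at arbitrary natural multiples of [2 pi / N] to
    [zchar]: the operations of ['Z_N] are those of [nat] followed by [%% N]. *)
Lemma expi_modn (m : nat) :
  expi (2 * pi * (m %% N)%N%:R / N%:R : R) = expi (2 * pi * m%:R / N%:R).
Proof.
rewrite [in RHS](divn_eq m N) natrD natrM.
have -> : 2 * pi * ((m %/ N)%:R * N%:R + (m %% N)%:R) / N%:R
        = 2 * pi * (m %/ N)%:R + 2 * pi * (m %% N)%:R / N%:R :> R by field.
by rewrite expiD expi_2pi_nat mul1r.
Qed.

(** The modulation operator multiplies representatives in [nat]; this turns its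
    phase into a character value at a product in ['Z_N]. *)
Lemma zcharM j n : expi (2 * pi * (j * n)%N%:R / N%:R : R) = zchar (j * n).
Proof.
rewrite -expi_modn /zchar; suff -> : (j * n)%R = (j * n %% N)%N :> nat by [].
by congr (_ %% _)%N; exact: Zp_cast.
Qed.

Lemma zcharD a b : zchar (a + b) = zchar a * zchar b.
Proof.
rewrite {1}/zchar; have -> : (a + b)%R = ((a + b) %% N)%N :> nat.
  by congr (_ %% _)%N; exact: Zp_cast.
by rewrite expi_modn natrD mulrDr mulrDl expiD.
Qed.

Lemma zchar0 : zchar 0 = 1.
Proof. by rewrite /zchar mulr0 mul0r expi0. Qed.

Lemma conj_zchar a : (zchar a)^* = zchar (- a).
Proof.
have u : zchar a * (zchar a)^* = 1.
  by rewrite -sqr_normcE normc_expi expr1n.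
have v : zchar a * zchar (- a) = 1 by rewrite -zcharD subrr zchar0.
have z0 : zchar a != 0.
  by apply/eqP=> z0; move/eqP: v; rewrite z0 mul0r eq_sym oner_eq0.
by apply: (mulfI z0); rewrite u v.
Qed.

Lemma normc_zchar a : normc (zchar a) = 1.
Proof. exact: normc_expi. Qed.

Lemma zchar_neq1 a : a != 0 -> zchar a != 1.
Proof.
move=> a0; apply: expi_neq1; have N0 : 0 < N%:R :> R by rewrite ltr0n ltnW.
have pi0 := pi_gt0 R.
have am : 0 < (a : nat)%:R :> R by rewrite ltr0n lt0n.
rewrite divr_gt0 ?mulr_gt0 //= ltr_pdivrMr // ltr_pM2l ?mulr_gt0 //.
by rewrite ltr_nat -[X in (_ < X)%N](Zp_cast N_gt1) ltn_ord.
Qed.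

(** Translating the summation variable by [1] multiplies the sum by
    [zchar j != 1] without changing it. *)
Lemma sum_zchar_eq0 j : j != 0 -> \sum_n zchar (j * n) = 0.
Proof.
move=> j0; set S := \sum_n _.
have : zchar j * S = S.
  rewrite /S mulr_sumr [RHS](reindex_inj (addIr 1)) /=.
  by apply: eq_bigr => n _; rewrite mulrDr mulr1 zcharD mulrC.
move/eqP; rewrite -subr_eq0 -{2}[S]mul1r -mulrBl mulf_eq0 subr_eq0.
by rewrite (negPf (zchar_neq1 j0)) => /eqP.
Qed.

End CyclicCharacters.

(** * Counting in difference sets *)

Section DifferenceSets.
Variables (N K lambda : nat) (A : {set 'Z_N}).
Hypothesis dsA : difference_set A K lambda.

(** Group the pairs of [A] by difference: [0] comes from the [K] diagonal pairs
    and every other [d] from [lambda] pairs.  With [F] constant this is the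
    relation between [N], [K] and [lambda]; with [F] a character it computes
    the power spectrum of [A]. *)
Lemma difference_set_sum (V : comNzRingType) (F : 'Z_N -> V) :
  \sum_(a in A) \sum_(b in A) F (a - b)
  = (K%:R - lambda%:R) * F 0 + lambda%:R * \sum_d F d.
Proof.
have [_ cA dA] := dsA.
rewrite pair_big /= (partition_big (fun p => p.1 - p.2) xpredT) //=.
rewrite (bigD1 0) //= [in RHS](bigD1 0) //= mulrDr addrA -mulrDl subrK.
congr (_ + _).
  rewrite (eq_bigr (fun=> F 0)); last by move=> p /andP[_ /eqP->].
  (* The pairs of difference [0] form the diagonal of [A]. *)
  rewrite (eq_bigl (mem ([set (a, a) | a in A]))).
    by rewrite sumr_const card_imset ?cA ?mulr_natl // => a b [].
  move=> [a b] /=; apply/idP/imsetP => [|[c cAc [-> ->]]].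
    by case/andP=> /andP[aA _]; rewrite subr_eq0 => /eqP <-; exists a.
  by rewrite cAc subrr eqxx.
rewrite mulr_sumr; apply: eq_bigr => d d0.
rewrite (eq_bigr (fun=> F d)); last by move=> p /andP[_ /eqP->].
rewrite sumr_const -(dA d d0) mulr_natl; congr (_ *+ _).
apply: eq_card => p; rewrite !inE /= -topredE /=.
case: (_ - _ =P d) => [e|]; last by rewrite !andbF.
by rewrite -subr_eq0 e d0.
Qed.

(** The map [n |-> (n - k, n - l)] is a bijection onto the pairs of elements of
    [A] whose difference is [l - k]. *)
Lemma card_cross_translates (k l : 'Z_N) :
  k != l -> #|[set n | (n - k \in A) && (n - l \in A)]| = lambda.
Proof.
move=> kl; have [_ _ dA] := dsA.
have d0 : l - k != 0 by rewrite subr_eq0 eq_sym.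
rewrite -(dA _ d0) -(card_imset _ (f := fun n => (n - k, n - l))); last first.
  by move=> m n /(congr1 fst) /addIr.
apply: eq_card => -[a b]; apply/imsetP/idP.
  case=> n; rewrite !inE => /andP[nk nl] [-> ->] /=.
  rewrite nk nl /=; have -> : n - k - (n - l) = l - k by ring.
  rewrite eqxx andbT; apply: contra d0 => /eqP/addrI/oppr_inj->.
  by rewrite subrr.
rewrite !inE /= => /andP[/andP[aA bA] /andP[_ /eqP e]].
have eb : a + k - l = b by rewrite -[a](subrK b) e; ring.
by exists (a + k); rewrite ?inE addrK eb ?aA ?bA.
Qed.

End DifferenceSets.

(** * Inner products of time-frequency shifts *)

Section GaborInnerProducts.
Variables (R : realType) (N : nat) (A : {set 'Z_N}).
Hypothesis N_gt1 : (1 < N)%N.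
Implicit Types (j k l d n : 'Z_N) (p q : 'Z_N * 'Z_N).

Definition cross_sum k l d : R[i] :=
  \sum_(n | (n - k \in A) && (n - l \in A)) zchar R (d * n).

(** The two phases combine into one character at [p.1 - q.1], and the two
    shifted indicators restrict [n] to the common part of the translates. *)
Lemma inner_gabor_system p q :
  inner (gabor_system R A p) (gabor_system R A q)
  = (#|A|%:R^-1)%:C * cross_sum p.2 q.2 (p.1 - q.1).
Proof.
case: p q => [j k] [j' l]; rewrite /inner /cross_sum /= mulr_sumr big_mkcond /=.
rewrite [RHS]big_mkcond /=; apply: eq_bigr => n _; rewrite !ffunE /=.
set c := real_complex _ (1 / _).
rewrite !zcharM // !(rmorphM Num.conj) /= conj_zchar // rmorph_nat.
rewrite (conj_Creal (x := c)); last by rewrite complex_real.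
rewrite mulrBl zcharD // -!mulrA.
case: (n - k \in A); case: (n - l \in A); rewrite /= ?(mulr0, mul0r) //.
(* The normalisation [c] is real, and enters once from each window. *)
have -> : (#|A|%:R^-1)%:C = c * c :> R[i].
  by rewrite /c -rmorphM /= -expr2 div1r exprVn sqr_sqrtr // ler0n.
by ring.
Qed.

Lemma normc_cross_sum_le k l d :
  normc (cross_sum k l d)
  <= #|[set n | (n - k \in A) && (n - l \in A)]|%:R.
Proof.
apply: le_trans (normc_sum_le _ _) _.
rewrite (eq_bigr (fun=> 1)) => [|n _]; last exact: normc_zchar.
by rewrite sumr_const cardsE.
Qed.

Lemma cross_sum0 k l :
  cross_sum k l 0 = #|[set n | (n - k \in A) && (n - l \in A)]|%:R.
Proof.
rewrite /cross_sum (eq_bigr (fun=> 1)) => [|n _]; last by rewrite mul0r zchar0.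
by rewrite sumr_const cardsE.
Qed.

(** Translating by [k] brings the sum back to [A] at the cost of a phase that
    the modulus does not see. *)
Lemma cross_sum_diag k d :
  cross_sum k k d = zchar R (d * k) * \sum_(a in A) zchar R (d * a).
Proof.
rewrite /cross_sum (reindex_inj (addIr k)) mulr_sumr /=.
apply: eq_big => [n|n _]; first by rewrite addrK andbb.
by rewrite mulrDr zcharD // mulrC.
Qed.

Lemma l2norm_gabor_system p : A != set0 -> l2norm (gabor_system R A p) = 1.
Proof.
move=> A0; rewrite /l2norm; set s := \sum_t _.
suff -> : s = 1 by rewrite sqrtr1.
apply: complexI; rewrite /s rmorph_sum /=.
under eq_bigr => t _ do rewrite sqr_normcE.
(* The squared norm is the inner product of the vector with itself. *)
rewrite -[LHS]/(inner _ _) inner_gabor_system subrr.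
rewrite cross_sum_diag mul0r zchar0 mul1r.
rewrite (eq_bigr (fun=> 1)) => [|n _]; last by rewrite mul0r zchar0.
rewrite sumr_const -(rmorph_nat (real_complex R)) -rmorphM /= mulVf //.
by rewrite pnatr_eq0 cards_eq0.
Qed.

End GaborInnerProducts.

(** * Mutual coherence *)

Section CoherenceBounds.
Variables (R : realType) (T I : finType) (Phi : I -> {ffun T -> R[i]}).

Definition coherence_term (p q : I) : R :=
  normc (inner (Phi p) (Phi q)) / (l2norm (Phi p) * l2norm (Phi q)).

Lemma coherence_term_le_mutual p q :
  p != q -> coherence_term p q <= mutual_coherence Phi.
Proof.
move=> pq; exact: (le_bigmax_cond (0 : R) (j := (p, q))
  (P := fun r => r.1 != r.2) (fun r => coherence_term r.1 r.2) pq).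
Qed.

Lemma mutual_coherence_le (x : R) :
  0 <= x -> (forall p q, p != q -> coherence_term p q <= x) ->
  mutual_coherence Phi <= x.
Proof. by move=> x0 le_x; apply: bigmax_le => // -[p q] /le_x. Qed.

End CoherenceBounds.

Section Coherence.
Variables (R : realType) (N K lambda : nat) (A : {set 'Z_N}).
Hypothesis N_gt1 : (1 < N)%N.
Hypothesis dsA : difference_set A K lambda.
Implicit Types (j k l d n : 'Z_N) (p q : 'Z_N * 'Z_N).

(** Counts [A x A] by differences; this is [K (K - 1) = lambda (N - 1)] without
    truncated subtraction. *)
Lemma difference_set_count : (K * K + lambda = K + lambda * N)%N.
Proof.
have := difference_set_sum dsA (fun=> 1 : int); have [_ cA _] := dsA.
under eq_bigr => a _ do rewrite sumr_const cA.
rewrite !sumr_const cA cardT size_enum_ord Zp_cast // mulr1 -!natrM.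
rewrite -mulrnA; lia.
Qed.

Let K_neq0 : K%:R != 0 :> R.
Proof. by have [A0 <- _] := dsA; rewrite pnatr_eq0 cards_eq0. Qed.

Let N1_neq0 : N%:R - 1 != 0 :> R.
Proof. by rewrite subr_eq0 pnatr_eq1 neq_ltn N_gt1 orbT. Qed.

(** The difference sum of the character [n |-> zchar (d * n)]: the sum over all
    of ['Z_N] vanishes and only the excess [K - lambda] at [0] remains. *)
Lemma sqr_normc_char_sum d :
  d != 0 -> normc (\sum_(a in A) zchar R (d * a)) ^+ 2 = K%:R - lambda%:R.
Proof.
move=> d0; apply: complexI; rewrite sqr_normcE rmorph_sum /= mulr_suml.
have e a : zchar R (d * a) * \sum_(b in A) (zchar R (d * b))^*
         = \sum_(b in A) zchar R (d * (a - b)).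
  rewrite mulr_sumr; apply: eq_bigr => b _.
  by rewrite conj_zchar // -zcharD // -mulrBr.
rewrite (eq_bigr _ (fun a _ => e a)).
rewrite (difference_set_sum dsA (fun n => zchar R (d * n))) sum_zchar_eq0 //.
by rewrite !mulr0 addr0 zchar0 mulr1 rmorphB /= !rmorph_nat.
Qed.

Local Notation gabor_term := (coherence_term (gabor_system R A)).

Lemma gabor_termE p q :
  gabor_term p q = normc (cross_sum R A p.2 q.2 (p.1 - q.1)) / K%:R.
Proof.
have [A0 cA _] := dsA.
rewrite /coherence_term !l2norm_gabor_system // mulr1 divr1.
rewrite inner_gabor_system //.
by rewrite ComplexField.Normc.normcM normc_real ?invr_ge0 ?ler0n // mulrC cA.
Qed.

Lemma lambda_div_card : lambda%:R / K%:R = (K%:R - 1) / (N%:R - 1) :> R.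
Proof.
have e : K%:R * K%:R + lambda%:R = K%:R + lambda%:R * N%:R :> R.
  by rewrite -!natrM -!natrD difference_set_count.
by apply/eqP; rewrite eqr_div //; apply/eqP; rewrite mulrBr mulrBl; lra.
Qed.

(** Substituting [lambda = K (K - 1) / (N - 1)] gives
    [K - lambda = K (N - K) / (N - 1)]. *)
Lemma gabor_term_same_shift j j' k : j != j' ->
  gabor_term (j, k) (j', k)
  = Num.sqrt ((N%:R - K%:R) / (K%:R * (N%:R - 1))).
Proof.
move=> jj'; rewrite gabor_termE /= cross_sum_diag //.
rewrite ComplexField.Normc.normcM normc_zchar mul1r.
set x := normc _; have x0 : 0 <= x by exact: normc_ge0.
have -> : (N%:R - K%:R) / (K%:R * (N%:R - 1)) = (x / K%:R) ^+ 2 :> R.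
  rewrite expr_div_n sqr_normc_char_sum ?subr_eq0 //.
  have -> : lambda%:R = (K%:R - 1) / (N%:R - 1) * K%:R :> R.
    by rewrite -lambda_div_card mulfVK.
  by field; rewrite N1_neq0 K_neq0.
by rewrite sqrtr_sqr ger0_norm // divr_ge0 ?ler0n.
Qed.

Lemma gabor_term_same_modulation j k l : k != l ->
  gabor_term (j, k) (j, l) = (K%:R - 1) / (N%:R - 1).
Proof.
move=> kl; rewrite gabor_termE /= subrr cross_sum0.
rewrite (card_cross_translates dsA) // -lambda_div_card.
by rewrite -(rmorph_nat (real_complex R)) normc_real ?ler0n.
Qed.

(** Among pairs with distinct shifts, equal modulations are the worst case, as
    all the phases are then aligned. *)
Lemma gabor_term_le p q : p.2 != q.2 ->
  gabor_term p q <= (K%:R - 1) / (N%:R - 1).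
Proof.
move=> kl; rewrite gabor_termE -lambda_div_card ler_wpM2r ?invr_ge0 ?ler0n //.
by rewrite -(card_cross_translates dsA kl) normc_cross_sum_le.
Qed.

(** Here [N - 1 = K (K - 1)], so that the two sides are [1 / K] and
    [sqrt (K - 1) / K]; and [1 < N] forces [K >= 2]. *)
Lemma planar_bound : lambda = 1%N ->
  (K%:R - 1) / (N%:R - 1)
  <= Num.sqrt ((N%:R - K%:R) / (K%:R * (N%:R - 1))) :> R.
Proof.
move=> l1; have eN : (N = K * K + 1 - K)%N by have := difference_set_count; lia.
have K2 : (2 <= K)%N by have := N_gt1; rewrite eN; nia.
have eR : N%:R - 1 = K%:R * (K%:R - 1) :> R.
  rewrite eN natrB ?natrD ?natrM; first by ring.
  by nia.
have k2 : 2 <= K%:R :> R by rewrite ler_nat.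
have K1_neq0 : K%:R - 1 != 0 :> R by rewrite lt0r_neq0 //; lra.
have -> : (K%:R - 1) / (N%:R - 1) = K%:R^-1 :> R.
  by rewrite eR; field; rewrite K_neq0.
have -> : (N%:R - K%:R) / (K%:R * (N%:R - 1)) = (K%:R - 1) * K%:R^-1 ^+ 2 :> R.
  have -> : N%:R = K%:R * (K%:R - 1) + 1 :> R by rewrite -eR subrK.
  by field; rewrite K_neq0 addrK mulf_neq0.
have K_inv : 0 <= K%:R^-1 :> R by rewrite invr_ge0 ler0n.
rewrite -{1}(ger0_norm K_inv) -sqrtr_sqr ler_wsqrtr //.
by rewrite ler_peMl ?sqr_ge0 //; lra.
Qed.

Lemma gabor_coherence :
  mutual_coherence (gabor_system R A)
  = Num.max ((K%:R - 1) / (N%:R - 1))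
            (Num.sqrt ((N%:R - K%:R) / (K%:R * (N%:R - 1)))).
Proof.
(* As [N >= 2], the elements [0] and [1] give a pair of distinct shifts and a
   pair of distinct modulations, at which the two values are attained. *)
have n01 : (0 : 'Z_N) != 1 by rewrite eq_sym oner_eq0.
apply/eqP; rewrite eq_le; apply/andP; split; last first.
  rewrite ge_max -(gabor_term_same_modulation 0 n01).
  rewrite -(gabor_term_same_shift 0 n01).
  by rewrite !coherence_term_le_mutual // xpair_eqE negb_and n01 ?orbT.
apply: mutual_coherence_le => [|[j k] [j' l] pq].
  by rewrite le_max sqrtr_ge0 orbT.
rewrite le_max.
have [e|kl] := eqVneq k l; last by rewrite gabor_term_le.
subst l; rewrite gabor_term_same_shift ?lexx ?orbT //.
by apply: contraNneq pq => ->.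
Qed.

End Coherence.

Theorem theorem2p9 (R : realType) (N K lambda : nat) (A : {set 'Z_N}) :
  (2 <= N)%N ->
  difference_set A K lambda ->
  mutual_coherence (@gabor_system R N A) =
    if lambda == 1%N
    then Num.sqrt ((N%:R - K%:R) / (K%:R * (N%:R - 1)))
    else Num.max ((K%:R - 1) / (N%:R - 1))
                 (Num.sqrt ((N%:R - K%:R) / (K%:R * (N%:R - 1)))).
Proof.
move=> N_gt1 dsA; rewrite (gabor_coherence R N_gt1 dsA).
by case: eqP => // l1; apply/max_idPr/(planar_bound R N_gt1 dsA).
Qed.
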